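(* Let $G$ be an elementary graph with $r(G)\geq 2$ and $Af(G)=r(G)$. Then $G$ has a unique perfect matching $M$ such that $af(G,M)=r(G)$.
   Context: All graphs are finite and simple. An edge of a graph is allowed if it belongs to some perfect matching of the graph; a graph $G$ with a perfect matching is elementary if its allowed edges form a connected subgraph of $G$ (hence $G$ is connected). For a perfect matching $M$ of $G$, a set $S\subseteq E(G)\setminus M$ is an anti-forcing set of $M$ if $M$ is the unique perfect matching of $G-S$; $af(G,M)$ is the minimum cardinality of an anti-forcing set of $M$. $Af(G)$ is the maximum of $af(G,M)$ over all perfect matchings $M$ of $G$. $r(G)=|E(G)|-|V(G)|+1$ is the cyclomatic number. *)

(* Defs.v *)
From mathcomp Require Import all_boot all_order all_algebra.

Set Implicit Arguments.
Unset Strict Implicit.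
Unset Printing Implicit Defensive.

(* A finite simple graph with vertex type T is given by its edge set
   E : {set {set T}}, whose members are two-element sets of vertices.  Deleting
   a set S of edges gives the graph E :\: S on the same vertices. *)
Section Graphs.
Variable T : finType.
Implicit Types E M S : {set {set T}}.

Definition simple_graph E : Prop := forall e, e \in E -> #|e| = 2.

Definition adjacent E : rel T := [rel x y | [set x; y] \in E].

Definition connected_graph E : Prop := forall x y : T, connect (adjacent E) x y.

Definition perfect_matching E M : bool :=
  [&& M \subset E, trivIset M & cover M == [set: T]].

Definition allowed_edges E : {set {set T}} :=
  [set e | [exists M, perfect_matching E M && (e \in M)]].

(* As E has a perfect matching, the allowed edges cover all vertices, so the
   subgraph they form is a spanning one. *)
Definition elementary E : Prop :=
  (exists M, perfect_matching E M) /\ connected_graph (allowed_edges E).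

Definition anti_forcing_set E M S : bool :=
  (S \subset E :\: M) &&
  [forall M', perfect_matching (E :\: S) M' == (M' == M)].

(* For a perfect matching M the starting point E :\: M of the minimization is
   itself an anti-forcing set (anti_forcing_setD below); the value is not
   meaningful for other M. *)
Definition af E M : nat :=
  #|[arg min_(S < E :\: M | anti_forcing_set E M S) #|S| ]|.

Definition Af E : nat := \max_(M | perfect_matching E M) af E M.

Definition cyclomatic_number E : int := (#|E|%:Z - #|T|%:Z + 1)%R.

Lemma anti_forcing_setD E M :
  simple_graph E -> perfect_matching E M -> anti_forcing_set E M (E :\: M).
Proof.
move=> simE pmM; have /and3P[sME trM cM] := pmM.
rewrite /anti_forcing_set subxx setDDr setDv set0U (setIidPr sME) /=.
apply/forallP=> M'; apply/eqP; apply/idP/eqP => [/and3P[sM'M _ /eqP cM']|->].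
  apply/eqP; rewrite eqEsubset sM'M; apply/subsetP=> e eM.
  have /card_gt0P[x xe] : 0 < #|e| by rewrite simE // (subsetP sME).
  have : x \in cover M' by rewrite cM' inE.
  case/bigcupP=> f fM' xf; have fM := subsetP sM'M _ fM'.
  by rewrite -(def_pblock trM eM xe) (def_pblock trM fM xf).
by rewrite /perfect_matching subxx trM.
Qed.

Lemma afP E M :
  simple_graph E -> perfect_matching E M ->
  (exists2 S, anti_forcing_set E M S & #|S| = af E M) /\
  (forall S, anti_forcing_set E M S -> af E M <= #|S|).
Proof.
move=> simE pmM; rewrite /af.
case: arg_minnP => [|S afS minS]; first exact: anti_forcing_setD.
by split=> //; exists S.
Qed.

End Graphs.

(* Main.v *)
Require Import Defs.
From mathcomp Require Import all_boot all_order all_algebra.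
From mathcomp Require Import zify.

(** Call a set F of non-matching edges harmless for a perfect matching M if M
is the only perfect matching in the union of M and F; the remaining edges are
then an anti-forcing set, so af(G,M) = r(G) forces every harmless set to have
fewer than |V|/2 edges.  Harmless sets can be grown greedily: starting from a
set of vertices W that is a union of M-edges, attach an M-edge bb* disjoint from
W by edges joining b to W.  Since b* is then a leaf, bb* is forced and nothing
else changes ([pinned_step]).  Every attachment gains at least one edge of F per
edge of M, and two when b has two neighbours in W.  Using this with W a
component of G - {b, b*}, and extending to all of G by connectivity, gives the
rigidity lemma [neighbors_separated]: if af(G,M) = r(G), then distinct
neighbours of b other than b* lie in different components of G - {b, b*}.

Now let M and M' be distinct and both attain r(G).  Some vertex b whose
partners x in M and y in M' differ has a third neighbour z: otherwise the
vertices with different partners would be closed under adjacency, hence would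
be all vertices, and G would be the union of M and M', so that r(G) <= 1
([third_neighbor]).  Because G is elementary, a path in G - b joins z to x
([elementary_delete], a parity argument).  Cut at its first visit to {x, y},
this path joins z to y outside {b, x} or z to x outside {b, y} ([first_hit]),
against rigidity for M or for M' respectively. *)

Set Implicit Arguments.
Unset Strict Implicit.
Unset Printing Implicit Defensive.

Lemma connect_exit (T : finType) (r : rel T) (Y : {set T}) z y :
  connect r z y -> z \in Y -> y \notin Y ->
  exists v w, [/\ v \in Y, w \notin Y & r v w].
Proof.
case/connectP=> p; elim: p z => [|w p IHp] z /= => [_ -> ->|] //.
case/andP=> rzw pathp yE zY yY; have [wY|wY] := boolP (w \in Y).
  exact: IHp pathp yE wY yY.
by exists z, w.
Qed.

(** * Partners in a perfect matching *)

Definition mate (T : finType) (M : {set {set T}}) (v : T) : T :=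
  odflt v [pick w | (w != v) && ([set v; w] \in M)].

Section Mates.
Variables (T : finType) (E M : {set {set T}}).
Hypotheses (simpleE : simple_graph E) (pmM : perfect_matching E M).
Implicit Types (v w : T) (W : {set T}).

Lemma edge_neq v w : [set v; w] \in E -> v != w.
Proof. by move/simpleE; rewrite cards2; case: (v != w). Qed.

Lemma matching_sub e : e \in M -> e \in E.
Proof. by case/and3P: pmM => /subsetP sME _ _ /sME. Qed.

Lemma matching_inj e f v : e \in M -> f \in M -> v \in e -> v \in f -> e = f.
Proof.
case/and3P: pmM => _ tM _ eM fM ve vf.
by rewrite -(def_pblock tM eM ve) (def_pblock tM fM vf).
Qed.

Lemma edge_at e v : e \in E -> v \in e -> exists2 w, w != v & e = [set v; w].
Proof.
move=> eE; have /eqP/cards2P[x [y [xy ->]]] := simpleE eE.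
rewrite !inE => /orP[] /eqP->; first by exists y; rewrite 1?eq_sym.
by exists x; rewrite // setUC.
Qed.

Lemma mate_edge v : [set v; mate M v] \in M.
Proof.
rewrite /mate; case: pickP => [w /andP[]|noM] //.
case/and3P: pmM => _ _ /eqP cM; have : v \in cover M by rewrite cM inE.
case/bigcupP=> e eM ve; have [w wv eE] := edge_at (matching_sub eM) ve.
by have:= noM w; rewrite wv -eE eM.
Qed.

Lemma mate_adj v : [set v; mate M v] \in E.
Proof. exact/matching_sub/mate_edge. Qed.

Lemma mate_neq v : mate M v != v.
Proof. by rewrite eq_sym edge_neq ?mate_adj. Qed.

Lemma mateP v w : [set v; w] \in M -> mate M v = w.
Proof.
move=> vwM; have eq2 := matching_inj (mate_edge v) vwM (set21 _ _) (set21 _ _).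
have: mate M v \in [set v; w] by rewrite -eq2 set22.
by rewrite !inE (negPf (mate_neq v)) => /eqP.
Qed.

Lemma mateK : involutive (mate M).
Proof. by move=> v; apply: mateP; rewrite setUC mate_edge. Qed.

Lemma matching_edge e v : e \in M -> v \in e -> e = [set v; mate M v].
Proof. by move=> eM ve; apply: matching_inj eM (mate_edge v) ve (set21 _ _). Qed.

Definition mate_closed W := forall v, v \in W -> mate M v \in W.

Lemma card_mate_closed W :
  mate_closed W -> #|W| = (#|[set e in M | e \subset W]| * 2)%N.
Proof.
move=> clW; set N := [set e in M | _].
have NM : N \subset M by apply/subsetP=> e; rewrite inE => /andP[].
have -> : W = cover N.
  apply/setP=> v; apply/idP/bigcupP=> [vW | [e]].
    exists [set v; mate M v]; rewrite ?set21 // inE mate_edge subUset !sub1set.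
    by rewrite vW clW.
  by rewrite inE => /andP[_ /subsetP]; apply.
case/and3P: pmM => _ tM _; have := trivIsetS NM tM; rewrite /trivIset => /eqP<-.
rewrite -sum_nat_const; apply: eq_bigr => e eN.
by rewrite simpleE // matching_sub // (subsetP NM).
Qed.

Lemma card_vertices : #|T| = (#|M| * 2)%N.
Proof.
rewrite -cardsT card_mate_closed; last by move=> v; rewrite !inE.
by congr (#|pred_of_set _| * 2)%N; apply/setP=> e; rewrite inE subsetT andbT.
Qed.

(** The uniqueness clause is about perfect matchings of the whole graph rather
than of W alone: outside W the union of M and F consists of isolated M-edges, so
the two readings agree, and the global one avoids restricting matchings. *)
Definition pinned W (F : {set {set T}}) :=
  [/\ mate_closed W, F \subset E :\: M, forall e, e \in F -> e \subset W
    & forall M', perfect_matching E M' -> M' \subset M :|: F -> M' = M].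

End Mates.

(** * Growing harmless edge sets *)

Section Growth.
Variables (T : finType) (E M : {set {set T}}).
Hypotheses (simpleE : simple_graph E) (pmM : perfect_matching E M).
Implicit Types (v w b z : T) (W X Y N A B : {set T}) (F : {set {set T}}).

(** The partner of b is a leaf of the enlarged subgraph, so its matching edge
is forced; that edge uses up b and thereby excludes all the new edges. *)
Lemma pinned_step W F b N :
  pinned E M W F -> b \notin W -> N \subset W ->
  (forall a, a \in N -> [set b; a] \in E) ->
  exists2 F', pinned E M (b |: (mate M b |: W)) F' & #|F'| = #|F| + #|N|.
Proof.
move=> [clW sFE sFW forceF] bW sNW adjN.
have mbW : mate M b \notin W.
  by apply: contra bW => /clW; rewrite (mateK simpleE pmM).
pose A := [set [set b; a] | a in N].
have NneqB a : a \in N -> a != b.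
  by move=> aN; apply: contraNneq bW => <-; apply: (subsetP sNW).
have disjFA : [disjoint F & A].
  apply/pred0P=> e /=; apply/negP=> /andP[eF /imsetP[a _ eE]].
  by case/negP: bW; apply: (subsetP (sFW _ eF)); rewrite eE set21.
exists (F :|: A); last first.
  rewrite cardsU disjoint_setI0 // cards0 subn0 card_in_imset // => a a' aN a'N eq2.
  have: a \in [set b; a'] by rewrite -eq2 set22.
  by rewrite !inE (negPf (NneqB a aN)) => /eqP.
split.
- move=> v; rewrite !inE => /or3P[/eqP->|/eqP->|/clW->]; rewrite ?orbT //.
    by rewrite eqxx orbT.
  by rewrite (mateK simpleE pmM) eqxx.
- rewrite subUset sFE; apply/subsetP=> _ /imsetP[a aN ->].
  rewrite inE adjN // andbT; apply: contra mbW => /(mateP simpleE pmM)->.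
  exact: (subsetP sNW).
- move=> e; rewrite inE => /orP[/sFW/subsetP sW | /imsetP[a aN ->]].
    by apply/subsetP=> v /sW vW; rewrite !inE vW !orbT.
  by rewrite subUset !sub1set !inE eqxx (subsetP sNW a aN) !orbT.
move=> M' pmM' sM'; apply: forceF => //; apply/subsetP=> e eM'.
have:= subsetP sM' e eM'; rewrite !inE => /or3P[->|->|/imsetP[a aN eE]] //.
  by rewrite orbT.
have := mate_edge simpleE pmM' (mate M b).
set f := [set _; _] => fM'.
(* The edge f of M' at the leaf can only be the M-edge at b. *)
have mbf : mate M b \in f by apply: set21.
have fE : f = [set b; mate M b].
  have:= subsetP sM' f fM'; rewrite !inE => /or3P[fM|/sFW/subsetP sW|/imsetP[c cN fE]].
  - by rewrite (matching_edge simpleE pmM fM mbf) (mateK simpleE pmM) setUC.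
  - by case/negP: mbW; apply: sW.
  - move: mbf; rewrite fE !inE (negPf (mate_neq simpleE pmM b)) => /eqP mbc.
    by case/negP: mbW; rewrite mbc (subsetP sNW).
have -> : e = f.
  by apply: (matching_inj pmM' (v := b)) => //; rewrite ?eE ?fE set21.
by rewrite fE (mate_edge simpleE pmM).
Qed.

Lemma card_pinned_step W b :
  mate_closed M W -> b \notin W -> #|b |: (mate M b |: W)| = #|W| + 2.
Proof.
move=> clW bW.
have mbW : mate M b \notin W.
  by apply: contra bW => /clW; rewrite (mateK simpleE pmM).
rewrite !cardsU1 !inE eq_sym (negPf (mate_neq simpleE pmM b)) bW mbW /=.
by rewrite addnC -addnA addnC; lia.
Qed.

(** Attaching a matching edge along at least one edge never increases
#|W| - 2 #|F|; the bound says this without truncated subtraction. *)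
Lemma pinned_grow W F X :
  pinned E M W F -> mate_closed M X -> W \subset X ->
  (forall Y, W \subset Y -> Y \proper X ->
     exists v w, [/\ v \in Y, w \in X, w \notin Y & [set v; w] \in E]) ->
  exists2 F', pinned E M X F' & #|X| + #|F| * 2 <= #|W| + #|F'| * 2.
Proof.
move=> pinW clX; move: {2}#|X| (leq_subr #|W| #|X|) => n.
elim: n W F pinW => [|n IHn] W F pinW len sWX grow.
  have /eqP WX : W == X by rewrite eqEcard sWX -subn_eq0 -leqn0.
  by exists F; rewrite -?WX.
have [WX | WX] := eqVneq W X; first by exists F; rewrite -?WX.
have pWX : W \proper X by rewrite properEneq WX.
have [v [b [vW bX bW vbE]]] := grow W (subxx W) pWX.
have [|a /set1P->|F' pinW' cF'] := pinned_step (N := [set v]) pinW bW.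
- by rewrite sub1set.
- by rewrite setUC.
have clW : mate_closed M W by case: pinW.
have cW' := card_pinned_step clW bW.
move: pinW' cW'; set W' := b |: _ => pinW' cW'.
have sW'X : W' \subset X by rewrite !subUset !sub1set bX sWX clX.
have sWW' : W \subset W' by rewrite /W' setUA subsetUr.
have := subset_leq_card sW'X.
have [|Y sY|F'' pinX cX] := IHn W' F' pinW' _ sW'X.
- by rewrite cW'; lia.
- by apply: grow; apply: subset_trans sY.
move=> _; exists F'' => //; move: cF' cX cW'; rewrite cards1; lia.
Qed.

Lemma af_pinned F :
  pinned E M [set: T] F -> af E M + #|M| + #|F| <= #|E|.
Proof.
case=> _ sFE _ forceF.
have sME : M \subset E by case/and3P: pmM.
have [_ minaf] := afP simpleE pmM.
have anti : anti_forcing_set E M ((E :\: M) :\: F).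
  rewrite /anti_forcing_set subsetDl /=; apply/forallP=> M'; apply/eqP.
  have keep e : (e \in E :\: (E :\: M :\: F)) = (e \in M :|: F).
    have [eM|] := boolP (e \in M); first by rewrite !inE eM (subsetP sME _ eM) andbF.
    have [eF|] := boolP (e \in F); last by rewrite !inE => /negPf-> /negPf->; case: (e \in E).
    by have:= subsetP sFE e eF; rewrite !inE eF => /andP[_ ->]; rewrite orbT.
  apply/idP/eqP => [/and3P[sM' tM' cM'] | ->].
    apply: forceF; last by apply/subsetP=> e /(subsetP sM'); rewrite keep.
    by rewrite /perfect_matching tM' cM' (subset_trans sM') ?subsetDl.
  case/and3P: pmM => _ tM cM; rewrite /perfect_matching tM cM !andbT.
  by apply/subsetP=> e eM; rewrite keep inE eM.
have := minaf _ anti.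
rewrite cardsDS // cardsDS //.
have := subset_leq_card sFE; rewrite cardsDS //.
have := subset_leq_card sME; move: #|E| #|M| #|F| (af E M); lia.
Qed.

(** * Paths avoiding a set of vertices *)

Definition avoiding (A : {set T}) : rel T :=
  [rel u v | [&& u \notin A, v \notin A & [set u; v] \in E]].

Lemma avoid_step A z v w :
  connect (avoiding A) z v -> v \notin A -> w \notin A -> [set v; w] \in E ->
  connect (avoiding A) z w.
Proof.
move=> zv vA wA vw; apply: connect_trans zv (connect1 _).
by rewrite /avoiding /= vA wA.
Qed.

Lemma avoid_end A z v : connect (avoiding A) z v -> z \notin A -> v \notin A.
Proof.
move=> zv zA; apply/negP=> vA.
have zA' : z \in ~: A by rewrite inE.
have vA' : v \notin ~: A by rewrite inE negbK.
have [u [w [_ wA /and3P[_]]]] := connect_exit zv zA' vA'.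
by move: wA; rewrite inE negbK => ->.
Qed.

Lemma avoidS A B z v :
  A \subset B -> connect (avoiding B) z v -> connect (avoiding A) z v.
Proof.
move=> sAB; apply: connect_sub => x y /and3P[xB yB xy]; apply: connect1.
by rewrite /avoiding /= xy (contra (subsetP sAB x)) // (contra (subsetP sAB y)).
Qed.

(** A path from z to x off b must leave K, the part reachable from z off b, x
and y, and can do so only into x or y. *)
Lemma first_hit b x y z :
  z != b -> z != x -> z != y -> x != b -> y != b -> x != y ->
  connect (avoiding [set b]) z x ->
  connect (avoiding [set b; x]) z y \/ connect (avoiding [set b; y]) z x.
Proof.
move=> zb zx zy xb yb xy zxcon; pose A := b |: [set x; y].
have zA : z \notin A by rewrite !inE !negb_or zb zx.
pose K := [set v | connect (avoiding A) z v].
have KA v : v \in K -> v \notin A by rewrite inE => /avoid_end; apply.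
have zK : z \in K by rewrite inE connect0.
have xK : x \notin K by apply/negP=> /KA; rewrite !inE eqxx orbT.
have [v [w [vK wK]]] := connect_exit zxcon zK xK.
rewrite /avoiding /= !inE => /and3P[vb wb vw].
have zv : connect (avoiding A) z v by move: vK; rewrite inE.
have:= KA v vK; rewrite !inE !negb_or => /and3P[_ vx vy].
have: w \in A.
  apply: contraNT wK => wA; rewrite inE; apply: avoid_step vw => //; exact: KA.
rewrite !inE (negPf wb) /= => /orP[] /eqP wE; rewrite {}wE in vw.
  right; apply: avoid_step vw; rewrite ?inE ?negb_or ?vb ?vy ?xb //.
  by apply: avoidS zv; rewrite subUset !sub1set !inE !eqxx !orbT.
left; apply: avoid_step vw; rewrite ?inE ?negb_or ?vb ?vx ?yb 1?eq_sym //.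
by apply: avoidS zv; rewrite subUset !sub1set !inE !eqxx !orbT.
Qed.

(** * Rigidity of the matchings attaining the cyclomatic number *)

Hypothesis connE : connected_graph E.
(* That is, af E M is at least the cyclomatic number. *)
Hypothesis af_max : #|E| < af E M + #|T|.

(** If z and z' lay in one component K, growing from the M-edge at z to K and
then attaching b by both edges bz and bz' would reach 2 #|F| >= #|W|; growing on
to all vertices would give a harmless set of at least #|T| / 2 edges, hence an
anti-forcing set of at most #|E| - #|T| edges. *)
Lemma neighbors_separated b z z' :
  [set b; z] \in E -> [set b; z'] \in E -> z != z' ->
  z != mate M b -> z' != mate M b ->
  ~~ connect (avoiding [set b; mate M b]) z z'.
Proof.
move=> bz bz' zz' zm z'm; apply/negP=> con.
set B := [set b; _] in con.
have zB : z \notin B by rewrite !inE negb_or zm eq_sym (edge_neq simpleE bz).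
pose K := [set v | connect (avoiding B) z v].
have KB v : v \in K -> v \notin B by rewrite inE => /avoid_end; apply.
have clB v : (mate M v \in B) = (v \in B).
  rewrite !inE -(inj_eq (can_inj (mateK simpleE pmM))) (mateK simpleE pmM) orbC.
  by rewrite (inj_eq (can_inj (mateK simpleE pmM))).
have clK : mate_closed M K.
  move=> v vK; rewrite inE; apply: (@avoid_step _ _ v); rewrite ?clB ?KB //.
    by move: vK; rewrite inE.
  exact: mate_adj.
have zK : z \in K by rewrite inE connect0.
have pin0 : pinned E M [set z; mate M z] set0.
  split=> [v|||M' pmM' sM'].
  - rewrite !inE => /orP[] /eqP->; rewrite ?(mateK simpleE pmM) eqxx ?orbT //.
  - exact: sub0set.
  - by move=> e; rewrite inE.
  - apply/eqP; rewrite eqEcard -(setU0 M) sM' setU0 /=.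
    by rewrite -(leq_pmul2r (isT : 0 < 2)) -!(card_vertices simpleE).
have [|Y sY|F pinK cF] := pinned_grow pin0 clK.
- by rewrite subUset !sub1set zK clK.
- case/properP=> sYK [y yK yY].
  have zY : z \in Y by apply: (subsetP sY); rewrite set21.
  move: (yK); rewrite inE => zy; have [v [w [vY wY vw]]] := connect_exit zy zY yY.
  have vK := subsetP sYK v vY.
  exists v, w; split=> //; last by case/and3P: vw.
  by rewrite inE; move: vK; rewrite inE => /connect_trans; apply; apply: connect1.
have bK : b \notin K by apply: contraL (set21 b (mate M b)) => /KB.
have [||F1 pin1 cF1] := pinned_step (N := [set z; z']) pinK bK.
- by rewrite subUset !sub1set zK inE.
- by move=> a /set2P[]->.
have [||Y sY|F2 pin2 cF2] := pinned_grow (X := [set: T]) pin1.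
- by move=> v; rewrite !inE.
- exact: subsetT.
- case/properP=> _ [y _ yY].
  have bY : b \in Y by apply: (subsetP sY); rewrite setU11.
  have [v [w [vY wY vw]]] := connect_exit (connE b y) bY yY.
  by exists v, w; rewrite inE; split.
have := af_pinned pin2; have := card_vertices simpleE pmM.
move: cF cF1 cF2; rewrite card_pinned_step // cardsT !cards2 cards0 zz'.
rewrite eq_sym (mate_neq simpleE pmM z); lia.
Qed.

End Growth.

(** * Elementary graphs with two matchings *)

Section TwoMatchings.
Variables (T : finType) (E : {set {set T}}).
Hypothesis simpleE : simple_graph E.

Lemma allowed_sub e : e \in allowed_edges E -> e \in E.
Proof. by rewrite inE => /existsP[M /andP[/matching_sub pm /pm]]. Qed.

Lemma elementary_connected : elementary E -> connected_graph E.
Proof.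
case=> _ con x y; apply: connect_sub (con x y) => u v uv.
exact/connect1/allowed_sub.
Qed.

(** Suppose the component K of z in G - b misses the M-partner of b.  Then M
matches K within itself, so #|K| is even.  As the allowed edges connect z to b,
some allowed edge joins K to b; a perfect matching M' containing it matches K
together with b within itself, so #|K| is odd. *)
Lemma elementary_delete M b z :
  elementary E -> perfect_matching E M -> z != b ->
  connect (avoiding E [set b]) z (mate M b).
Proof.
move=> [_ con] pmM zb; apply/negPn/negP=> zx.
have zB : z \notin [set b] by rewrite inE.
pose K := [set v | connect (avoiding E [set b]) z v].
have KB v : v \in K -> v != b by rewrite inE => /avoid_end/(_ zB); rewrite inE.
have stepK v w : v \in K -> w != b -> [set v; w] \in E -> w \in K.
  move=> vK wb vw; rewrite inE; apply: avoid_step vw; rewrite ?inE ?wb ?KB //.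
  by move: vK; rewrite inE.
have zK : z \in K by rewrite inE connect0.
have bK : b \notin K by apply/negP=> /KB/eqP.
have [v [w [vK wK vw]]] := connect_exit (con z b) zK bK.
have wb : w = b.
  apply/eqP; apply: contraNT wK => wb; apply: stepK vK wb _.
  exact: allowed_sub.
move: vw; rewrite {}wb /adjacent /= inE => /existsP[M' /andP[pmM' vbM']].
have clK : mate_closed M K.
  move=> u uK; apply: (stepK u) => //; last exact: mate_adj.
  apply: contraNneq zx => mub; rewrite -[in mate M b]mub (mateK simpleE pmM).
  by move: uK; rewrite inE.
have clbK : mate_closed M' (b |: K).
  move=> u /setU1P[->|uK].
    have -> : mate M' b = v by apply: (mateP simpleE pmM'); rewrite setUC.
    by rewrite in_setU1 vK orbT.
  rewrite in_setU1; have [//|ub] := eqVneq (mate M' u) b.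
  by apply: (stepK u) => //; apply: mate_adj.
have := card_mate_closed simpleE pmM clK.
have := card_mate_closed simpleE pmM' clbK.
rewrite cardsU1 bK; lia.
Qed.

(** When no vertex of the set B of disagreement has a third neighbour, B is
closed under adjacency, so it is everything, and E is the union of M1 and M2,
which has at most #|T| edges. *)
Lemma third_neighbor M1 M2 :
  connected_graph E -> perfect_matching E M1 -> perfect_matching E M2 ->
  M1 != M2 -> #|T| < #|E| ->
  exists b z, [/\ mate M1 b != mate M2 b, [set b; z] \in E,
                  z != mate M1 b & z != mate M2 b].
Proof.
move=> con pm1 pm2 neqM ltTE.
pose B := [set v | mate M1 v != mate M2 v].
have [/existsP[b /existsP[z /and4P[]]]|none] := boolP [exists b, exists z,
    [&& mate M1 b != mate M2 b, [set b; z] \in E,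
        z != mate M1 b & z != mate M2 b]]; first by exists b, z.
have deg2 b z : b \in B -> [set b; z] \in E -> z = mate M1 b \/ z = mate M2 b.
  rewrite inE => bB bz; case: (eqVneq z (mate M1 b)) => [|z1]; first by left.
  case: (eqVneq z (mate M2 b)) => [|z2]; first by right.
  by case/existsP: none; exists b; apply/existsP; exists z; rewrite bB bz z1 z2.
have clB v w : v \in B -> [set v; w] \in E -> w \in B.
  move=> vB vw; move: (vB); rewrite !inE => neqv.
  case: (deg2 v w vB vw) => ->; apply: contra neqv => /eqP.
    rewrite (mateK simpleE pm1) => /(congr1 (mate M2)).
    by rewrite (mateK simpleE pm2) => ->.
  rewrite (mateK simpleE pm2) => /(congr1 (mate M1)).
  by rewrite (mateK simpleE pm1) => ->.
have [b bB | B0] := pickP [in B]; last first.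
  case/eqP: neqM; apply/eqP; rewrite eqEcard.
  (* Perfect matchings are equinumerous, so one inclusion suffices. *)
  rewrite -(leq_pmul2r (isT : 0 < 2)).
  rewrite -(card_vertices simpleE pm1) -(card_vertices simpleE pm2) leqnn andbT.
  apply/subsetP=> e eM1.
  have /card_gt0P[v ve] : 0 < #|e| by rewrite simpleE // (matching_sub pm1).
  rewrite (matching_edge simpleE pm1 eM1 ve).
  have := B0 v; rewrite /= inE => /negbFE/eqP->; exact: (mate_edge simpleE pm2).
have allB v : v \in B.
  apply/negPn/negP=> vB; have [x [y [xB yB xy]]] := connect_exit (con b v) bB vB.
  by rewrite (clB x) in yB.
have sE : E \subset M1 :|: M2.
  apply/subsetP=> e eE.
  have /card_gt0P[v ve] : 0 < #|e| by rewrite simpleE.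
  have [w _ evw] := edge_at simpleE eE ve; rewrite evw in eE *.
  rewrite inE; case: (deg2 v w (allB v) eE) => ->.
    by rewrite (mate_edge simpleE pm1).
  by rewrite (mate_edge simpleE pm2) orbT.
have := subset_leq_card sE; have [+ _] := leq_card_setU M1 M2.
have := card_vertices simpleE pm1; have := card_vertices simpleE pm2.
by move: ltTE; move: #|E| #|M1| #|M2| #|_ :|: _| #|T|; lia.
Qed.

End TwoMatchings.

Theorem corollary3p6 (T : finType) (E : {set {set T}})
    (simpleE : simple_graph E) (elemE : elementary E)
    (r_ge2 : (2%:Z <= cyclomatic_number E)%R)
    (AfE : (Af E)%:Z%R = cyclomatic_number E) :
  exists! M : {set {set T}},
    perfect_matching E M /\ (af E M)%:Z%R = cyclomatic_number E.
Proof.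
have [M0 pm0] := elemE.1; have connE := elementary_connected elemE.
have [M pmM AfM] := eq_bigmax_cond (af E) (introT card_gt0P (ex_intro _ M0 pm0)).
exists M; split=> [|M' [pmM' afM']].
  by split=> //; rewrite -AfE /Af AfM.
have afM : (af E M)%:Z%R = cyclomatic_number E by rewrite -AfE /Af AfM.
apply/eqP/negPn/negP=> neqM.
have ltE N : (af E N)%:Z%R = cyclomatic_number E -> #|E| < af E N + #|T|.
  by rewrite /cyclomatic_number; lia.
have [|b [z [neqb bz zx zy]]] := third_neighbor simpleE connE pmM pmM' neqM.
  by move: r_ge2; rewrite /cyclomatic_number; lia.
have sep := neighbors_separated simpleE pmM connE (ltE _ afM) bz.
have sep' := neighbors_separated simpleE pmM' connE (ltE _ afM') bz.
have bx := mate_adj simpleE pmM b; have bx' := mate_adj simpleE pmM' b.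
have zb : z != b by rewrite eq_sym (edge_neq simpleE bz).
have [||zx'|z'x] := first_hit zb zx zy _ _ neqb
                        (elementary_delete simpleE elemE pmM zb).
- exact: mate_neq simpleE pmM b.
- exact: mate_neq simpleE pmM' b.
- by apply/negP: zx'; apply: sep bx' zy zx _; rewrite eq_sym.
- by case/negP: (sep' _ bx zx zy neqb).
Qed.
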